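(* For every integer $b \ge 2$, the base-$b$ child graph $G_c$ contains an infinite path; that is, there is an infinite sequence of positive integers $a(1), a(2), a(3), \ldots$ such that $a(n+1)$ is a comma-child of $a(n)$ in base $b$ for every $n \ge 1$.
   Context: Fix a base $b \ge 2$. For a positive integer $n$, let $\delta(n)$ denote its leading (most significant, nonzero) base-$b$ digit. For positive integers $k, k'$, we say that $k'$ is a comma-child of $k$ (in base $b$) if $k' - k = d\cdot b + \delta(k')$, where $d = k \bmod b$ is the last base-$b$ digit of $k$. The child graph $G_c$ (in base $b$) is the directed graph whose nodes are the positive integers, with an edge from $i$ to $j$ exactly when $j$ is a comma-child of $i$. Paths are directed paths. *)

(* Defs.v *)
From mathcomp Require Import all_boot.

Set Implicit Arguments.
Unset Strict Implicit.
Unset Printing Implicit Defensive.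

(* For 1 < b and 0 < n, [trunc_log b n] is the exponent e such that
   b ^ e <= n < b ^ e.+1, i.e. the position of the most significant digit. *)
Definition leading_digit (b n : nat) : nat := n %/ b ^ trunc_log b n.

Definition last_digit (b n : nat) : nat := n %% b.

(* The defining equation k' - k = d * b + delta(k') is an equation between
   integers; it is written additively to avoid truncated subtraction. *)
Definition comma_child (b k k' : nat) : bool :=
  k' == k + (last_digit b k * b + leading_digit b k').

(* Edge relation of the child graph, whose nodes are the positive integers. *)
Definition child_graph (b : nat) : rel nat :=
  [rel i j : nat | [&& 0 < i, 0 < j & comma_child b i j]].

(* Main.v *)
Require Import Defs.
From mathcomp Require Import all_boot.
From Stdlib Require Import Classical ClassicalEpsilon.

(* Subtracting the leading digit of [j] exposes the last digit of its parent,
   so every [j >= b ^ 2] has a (smaller) parent, while edges have length less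
   than [b ^ 2].  Hence every node descends from one of the finitely many nodes
   below [b ^ 2], and every node has finitely many children: Koenig's lemma
   provides an infinite path. *)

(** For sets of naturals this is infinitude, stated without counting. *)
Definition unbounded (P : nat -> Prop) : Prop :=
  forall m, exists2 j, m <= j & P j.

Lemma unbounded_pigeonhole (N : nat) (Q : nat -> nat -> Prop) :
  unbounded (fun j => exists2 i, i < N & Q i j) ->
  exists2 i, i < N & unbounded (Q i).
Proof.
elim: N => [|N IHN] unbQ; first by have [j _ []] := unbQ 0.
have [|nunbN] := classic (unbounded (Q N)); first by exists N.
have [m nQN] := not_all_ex_not _ _ nunbN.
have [|i lt_iN unbi] := IHN; last by exists i; rewrite ?leqW.
(* Beyond [m] no [j] satisfies [Q N j], so its witness [i] lies strictly below [N]. *)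
move=> m'; have [j] := unbQ (maxn m m').
rewrite geq_max => /andP[le_mj le_m'j] [i]; rewrite ltnS leq_eqVlt.
case/predU1P=> [-> QNj | lt_iN Qij]; first by case: nQN; exists j.
by exists j => //; exists i.
Qed.

Section Koenig.

Variables (e : rel nat) (N c : nat).
Hypothesis parent : forall j, N <= j -> exists2 i, i < j & e i j.
Hypothesis edge_bound : forall i j, e i j -> j < i + c.

Definition descendant (i j : nat) : Prop :=
  exists2 p, path e i p & last i p = j.

(** Passing to a parent strictly decreases the node, so the ascent must end below [N]. *)
Lemma descendant_of_root (j : nat) : exists2 i, i < N & descendant i j.
Proof.
elim/ltn_ind: j => j IHj.
have [/parent[k lt_kj ekj] | lt_jN] := leqP N j; last first.
  by exists j => //; exists [::].
have [i lt_iN [p ep lastp]] := IHj k lt_kj.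
exists i => //; exists (rcons p j); last by rewrite last_rcons.
by rewrite rcons_path ep lastp.
Qed.

Lemma unbounded_descendants_child (i : nat) : unbounded (descendant i) ->
  exists j, e i j /\ unbounded (descendant j).
Proof.
move=> unbi.
(* The pigeonhole only yields some [j < i + c]; keeping the edge inside [Q] ensures that this [j] is
   a child of [i]. *)
pose Q j k := e i j /\ descendant j k.
have [m|j _ unbj] := unbounded_pigeonhole (i + c) Q.
  (* The bound [i.+1] rules out the empty path, which ends at [i] itself. *)
  have [k le_k [[|j p] /=]] := unbi (maxn m i.+1).
    by move=> _ def_k; rewrite -def_k geq_max ltnn andbF in le_k.
  case/andP=> eij ep lastp.
  exists k; first by rewrite (leq_trans (leq_maxl _ _) le_k).
  by exists j; [exact: edge_bound | split=> //; exists p].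
exists j; split; first by have [k _ []] := unbj 0.
by move=> m; have [k le_mk []] := unbj m; exists k.
Qed.

Lemma koenig : exists a : nat -> nat, forall n, e (a n) (a n.+1).
Proof.
have [m|r _ unbr] := unbounded_pigeonhole N descendant.
  by exists m => //; exact: descendant_of_root.
(* [epsilon] makes the choice total; its value is arbitrary at nodes without a suitable child, which
   the iteration from [r] never meets. *)
pose next i :=
  epsilon (inhabits 0) (fun j => e i j /\ unbounded (descendant j)).
have nextP i : unbounded (descendant i) ->
    e i (next i) /\ unbounded (descendant (next i)).
  by move/unbounded_descendants_child/(epsilon_spec (inhabits 0)).
have unb n : unbounded (descendant (iter n next r)).
  by elim: n => //= n /nextP[].
by exists (fun n => iter n next r) => n; have [] := nextP _ (unb n).
Qed.

End Koenig.

Lemma leading_digit_bounds (b n : nat) : 1 < b -> 0 < n ->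
  0 < leading_digit b n < b.
Proof.
move=> b_gt1 n_gt0; have /andP[le_bn lt_nb] := trunc_log_bounds b_gt1 n_gt0.
have pow_gt0 : 0 < b ^ trunc_log b n by rewrite expn_gt0 ltnW.
by rewrite divn_gt0 // le_bn ltn_divLR // -expnS.
Qed.

Lemma digit_pair_bound (b d f : nat) : d < b -> f < b -> d * b + f < b ^ 2.
Proof.
move=> lt_db lt_fb; apply: (@leq_trans (d.+1 * b)).
  by rewrite mulSn addnC ltn_add2r.
by rewrite -mulnn leq_mul2r lt_db orbT.
Qed.

Lemma child_graph_bound (b i j : nat) :
  1 < b -> child_graph b i j -> j < i + b ^ 2.
Proof.
move=> b_gt1 /and3P[_ j_gt0 /eqP {1}->]; rewrite ltn_add2l.
have /andP[_ lt_fb] := leading_digit_bounds _ _ b_gt1 j_gt0.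
by rewrite digit_pair_bound // ltn_mod ltnW.
Qed.

Lemma child_graph_parent (b j : nat) : 1 < b -> b ^ 2 <= j ->
  exists2 i, i < j & child_graph b i j.
Proof.
move=> b_gt1 le_b2j; have b_gt0 := ltnW b_gt1.
have j_gt0 : 0 < j by rewrite (leq_trans _ le_b2j) // expn_gt0 b_gt0.
have /andP[f_gt0 lt_fb] := leading_digit_bounds _ _ b_gt1 j_gt0.
set f := leading_digit b j in f_gt0 lt_fb.
(* This choice is forced: [j = i + (d * b + f)] gives [i] congruent to [j - f] modulo [b]. *)
pose d := (j - f) %% b; have lt_db : d < b by rewrite ltn_mod.
have lt_j : d * b + f < j.
  by rewrite (leq_trans (digit_pair_bound _ _ _ lt_db lt_fb)).
pose i := j - (d * b + f).
have def_j : j = i + (d * b + f) by rewrite subnK // ltnW.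
have last_i : last_digit b i = d.
  by rewrite /d def_j addnA addnK /last_digit addnC modnMDl.
exists i.
  by rewrite [ltnRHS]def_j -addn1 leq_add2l (leq_trans f_gt0) ?leq_addl.
apply/and3P; split; rewrite ?subn_gt0 //.
by rewrite /comma_child last_i -/f -def_j.
Qed.

Theorem theorem5p6 (b : nat) (hb : 2 <= b) :
  exists a : nat -> nat,
    forall n : nat, 1 <= n -> 0 < a n /\ child_graph b (a n) (a n.+1).
Proof.
(* Both constants come from [d * b + f < b ^ 2]: it keeps the parent positive and bounds the length
   of an edge. *)
have [|i j|a ea] := koenig (child_graph b) (b ^ 2) (b ^ 2).
- by move=> j; apply: child_graph_parent.
- exact: child_graph_bound.
by exists a => n _; split=> //; case/and3P: (ea n).
Qed.
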